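(* Let $n,m,k$ be positive integers, let $X\in\mathbb{R}^{n\times n}$ be symmetric, let $\Lambda:\mathbb{R}^{n\times n}\to\mathbb{R}^{m\times m}$ be a linear map and $Y\in\mathbb{R}^{m\times m}$. Let $\xi$ be the optimal value of \[ \max_{\rho\in\mathbb{R}^{n\times n}}\ \operatorname{Tr}(X\rho)\quad\text{s.t.}\quad \Lambda(\rho)=Y,\ \operatorname{Tr}(\rho)=1,\ \rho\ge 0,\ \operatorname{rank}(\rho)\le k . \] For a positive integer $N$, let $\mathcal{H}_A=\cdots=\mathcal{H}_Z=\mathbb{R}^n\otimes\mathbb{R}^k$ be $N$ copies (parties $A,\dots,Z$), $\widetilde{X}=X\otimes\mathbb{1}_k$, $\widetilde{\Lambda}(\cdot)=\Lambda[\operatorname{Tr}_2(\cdot)]$ with $\operatorname{Tr}_2$ the partial trace over $\mathbb{R}^k$, and let $\xi_N$ be the optimal value of the semidefinite program over real symmetric matrices $\Phi_{AB\cdots Z}$ \[ \max\ \operatorname{Tr}\big[(\widetilde{X}_A\otimes\mathbb{1}_{B\cdots Z})\Phi_{AB\cdots Z}\big]\ \text{s.t.}\ \Phi_{AB\cdots Z}\ge0,\ \operatorname{Tr}(\Phi_{AB\cdots Z})=1,\ P_N^+\Phi_{AB\cdots Z}P_N^+=\Phi_{AB\cdots Z},\ \Phi_{AB\cdots Z}^{T_A}=\Phi_{AB\cdots Z}, \] \[ (\widetilde{\Lambda}_A\otimes\mathrm{id}_{B\cdots Z})(\Phi_{AB\cdots Z})=Y\otimes\operatorname{Tr}_A(\Phi_{AB\cdots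 Z}). \] Then $\xi\le\xi_N$ for every $N$, $\xi_{N+1}\le\xi_N$ for all $N$, and $\lim_{N\to+\infty}\xi_N=\xi$.
   Context: $P_N^+=\frac{1}{N!}\sum_{\sigma\in S_N}V_\sigma$ is the orthogonal projector onto the symmetric subspace of $(\mathbb{R}^n\otimes\mathbb{R}^k)^{\otimes N}$, where $V_\sigma$ permutes the $N$ tensor factors. $\Phi^{T_A}$ is the partial transpose on the first party with respect to the standard basis. A subscript $A$ indicates action on the first party, $\mathrm{id}_{B\cdots Z}$ the identity map on the remaining parties, $\operatorname{Tr}_A$ the partial trace over the first party. *)

(* Defs.v *)
From HB Require Import structures.
From mathcomp Require Import all_boot all_order all_algebra all_fingroup.
From mathcomp Require Import all_classical all_reals all_analysis.
Set Implicit Arguments. Unset Strict Implicit. Unset Printing Implicit Defensive.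
Import Order.TTheory GRing.Theory Num.Theory.
Local Open Scope classical_set_scope.
Local Open Scope ring_scope.

(* Square "matrices" indexed by an arbitrary finite type T are represented
   as functions T -> T -> R (entries in the standard basis indexed by T). *)
Section FunMatrices.
Variable R : realType.

Definition ftr (T : finType) (A : T -> T -> R) : R := \sum_(i : T) A i i.
Definition fmul (T : finType) (A B : T -> T -> R) : T -> T -> R :=
  fun i j => \sum_(l : T) A i l * B l j.
Definition fkron (T1 T2 : finType) (A : T1 -> T1 -> R) (B : T2 -> T2 -> R) :
  (T1 * T2)%type -> (T1 * T2)%type -> R :=
  fun a b => A a.1 b.1 * B a.2 b.2.
Definition fid (T : finType) : T -> T -> R := fun a b => (a == b)%:R.

Definition fpsd (T : finType) (A : T -> T -> R) : Prop :=
  (forall i j, A i j = A j i) /\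
  (forall v : T -> R, 0 <= \sum_(i : T) \sum_(j : T) v i * A i j * v j).
Definition psdmx (n : nat) (A : 'M[R]_n) : Prop := fpsd (fun i j => A i j).
End FunMatrices.

Section Problem.
Variables (R : realType) (n m k : nat).
Variables (X : 'M[R]_n) (Lam : {linear 'M[R]_n -> 'M[R]_m}) (Y : 'M[R]_m).

(* The original (rank-constrained) problem; optimal value as a supremum in
   the extended reals (-oo if infeasible). *)
Definition xi_feasible : set 'M[R]_n :=
  [set rho | Lam rho = Y /\ \tr rho = 1 /\ psdmx rho /\ (\rank rho <= k)%N].
Definition xi_val : \bar R :=
  ereal_sup [set (\tr (X *m rho))%:E | rho in xi_feasible].

(* One party: R^n (x) R^k, basis indexed by 'I_n * 'I_k. *)
Definition Pty := ('I_n * 'I_k)%type.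
(* N.+1 parties A, B, ..., Z; party A is ord0. *)
Definition Idx (N : nat) := {ffun 'I_N.+1 -> Pty}.
Definition Rest (N : nat) := {ffun 'I_N -> Pty}.

Definition join (N : nat) (p : Pty) (r : Rest N) : Idx N :=
  [ffun i : 'I_N.+1 => if unlift ord0 i is Some j then r j else p].
Definition rest (N : nat) (a : Idx N) : Rest N :=
  [ffun j : 'I_N => a (lift ord0 j)].
Definition setA (N : nat) (a : Idx N) (p : Pty) : Idx N :=
  [ffun i => if i == ord0 then p else a i].

Definition Xt : Pty -> Pty -> R := fkron (fun i j => X i j) (@fid R _).
Definition XA (N : nat) : Idx N -> Idx N -> R :=
  fun a b => Xt (a ord0) (b ord0) * fid R (rest a) (rest b).

Definition Vperm (N : nat) (s : {perm 'I_N.+1}) : Idx N -> Idx N -> R :=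
  fun a b => (a == [ffun i => b (s i)])%:R.
Definition Psym (N : nat) : Idx N -> Idx N -> R :=
  fun a b => (N.+1)`!%:R^-1 * \sum_(s : {perm 'I_N.+1}) Vperm s a b.

Definition ptA (N : nat) (Phi : Idx N -> Idx N -> R) : Idx N -> Idx N -> R :=
  fun a b => Phi (setA a (b ord0)) (setA b (a ord0)).

Definition trA (N : nat) (Phi : Idx N -> Idx N -> R) : Rest N -> Rest N -> R :=
  fun r r' => \sum_(p : Pty) Phi (join p r) (join p r').

Definition tr2 (sigma : Pty -> Pty -> R) : 'M[R]_n :=
  \matrix_(i, j) \sum_(l : 'I_k) sigma (i, l) (j, l).
Definition Lt (sigma : Pty -> Pty -> R) : 'M[R]_m := Lam (tr2 sigma).

(* (Lambdatilde_A (x) id_{B..Z})(Phi), acting blockwise (linear extension) *)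
Definition LtA (N : nat) (Phi : Idx N -> Idx N -> R) :
  ('I_m * Rest N)%type -> ('I_m * Rest N)%type -> R :=
  fun c d => Lt (fun p p' => Phi (join p c.2) (join p' d.2)) c.1 d.1.

Definition sdp_feasible (N : nat) : set (Idx N -> Idx N -> R) :=
  [set Phi |
    fpsd Phi /\ ftr Phi = 1 /\
    (forall a b, fmul (fmul (@Psym N) Phi) (@Psym N) a b = Phi a b) /\
    (forall a b, ptA Phi a b = Phi a b) /\
    (forall c d, LtA Phi c d = fkron (fun i j => Y i j) (trA Phi) c d)].

(* xiSDP N is the value xi_{N+1} of the SDP with N.+1 parties. *)
Definition xiSDP (N : nat) : \bar R :=
  ereal_sup [set (ftr (fmul (@XA N) Phi))%:E | Phi in @sdp_feasible N].
End Problem.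

(* Main.v *)
Require Import Defs.
From HB Require Import structures.
From mathcomp Require Import all_boot all_order all_algebra all_fingroup.
From mathcomp Require Import ring lra.
From mathcomp Require Import all_classical all_reals all_analysis.
Import Order.TTheory GRing.Theory Num.Theory.
Import numFieldNormedType.Exports.
Local Open Scope classical_set_scope.
Local Open Scope ring_scope.

(* A feasible rho of rank at most k is F F^T with F of size n x k, so it is the
   marginal of phi phi^T where phi is F seen as a vector; tensor powers of
   phi phi^T are feasible for the SDP.  Tracing out the last party of a feasible
   Phi keeps it feasible, which gives monotonicity.

   For the limit, measure all M parties of a feasible Phi with the POVM
   proportional to the projectors on e_i + e_j and e_i - e_j.  The outcomes form
   an exchangeable sequence s; averaging the dual frame over the outcomes gives a
   random matrix Z(s) of trace 1 in a fixed box, with E[\tr (X~ Z)] equal to the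
   objective value of Phi.  Symmetry and invariance under partial transposition
   make the entries of Phi totally symmetric in all indices, hence the
   polynomials Z_ij Z_kl - Z_ik Z_jl and the entries of
   Lam (tr2 Z) - (\tr Z) Y have second moment O(1/M): only coinciding parties
   contribute.  A matrix Z of trace 1 on which these polynomials vanish is
   x x^T for a feasible point, so by compactness, for every c > xi,
   \tr (X~ Z) <= c + C * (sum of their squares) on the box.  Taking
   expectations, the value of the SDP is at most c + O(1/M). *)

(** * Positive semidefinite matrices *)

Lemma sum_pushforward {R : comPzRingType} {T T' : finType} (g : T' -> T)
    (v : T' -> R) (F : T -> R) :
  \sum_i v i * F (g i) = \sum_t (\sum_(i | g i == t) v i) * F t.
Proof.
rewrite (partition_big g predT) //=; apply: eq_bigr => t _.
by rewrite mulr_suml; apply: eq_bigr => i /eqP ->.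
Qed.

Lemma sum_delta {R : comPzRingType} {T : finType} (x : T) (F : T -> R) :
  \sum_t (x == t)%:R * F t = F x.
Proof.
rewrite (bigD1 x) //= eqxx mul1r big1 ?addr0 // => t.
by rewrite eq_sym => /negPf ->; rewrite mul0r.
Qed.

(** The form of the pulled-back matrix at [v] is the form of [A] at the push-forward of [v] along
    [g]. *)
Lemma fpsd_comp {R : realType} {T T' : finType} (g : T' -> T)
    (A : T -> T -> R) :
  fpsd A -> fpsd (fun i j => A (g i) (g j)).
Proof.
move=> [Asym Apos]; split=> [i j|v]; first exact: Asym.
have := Apos (fun t => \sum_(i | g i == t) v i).
set w := (fun t => _); congr (_ <= _); symmetry.
transitivity (\sum_i v i * \sum_j v j * A (g i) (g j)).
  apply: eq_bigr => i _; rewrite big_distrr /=; apply: eq_bigr => j _.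
  by rewrite [v j * _]mulrC mulrA.
rewrite (sum_pushforward g v (fun t => \sum_j v j * A t (g j))).
apply: eq_bigr => t _; rewrite (sum_pushforward g v) big_distrr /=.
by apply: eq_bigr => t' _; rewrite [X in _ * X]mulrC mulrA.
Qed.

Lemma fpsd_sum {R : realType} {T I : finType} (A : I -> T -> T -> R) :
  (forall p, fpsd (A p)) -> fpsd (fun i j => \sum_p A p i j).
Proof.
move=> Apsd; split=> [i j|v].
  by apply: eq_bigr => p _; case: (Apsd p) => ->.
have -> : \sum_i \sum_j v i * (\sum_p A p i j) * v j =
          \sum_p \sum_i \sum_j v i * A p i j * v j.
  rewrite [RHS]exchange_big; apply: eq_bigr => i _.
  rewrite [RHS]exchange_big; apply: eq_bigr => j _.
  by rewrite mulr_sumr mulr_suml.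
by apply: sumr_ge0 => p _; case: (Apsd p).
Qed.

Lemma fpsd_outer {R : realType} {T : finType} (u : T -> R) :
  fpsd (fun i j => u i * u j).
Proof.
split=> [i j|v]; first exact: mulrC.
have -> : \sum_i \sum_j v i * (u i * u j) * v j = (\sum_i v i * u i) ^+ 2.
  rewrite expr2 mulr_suml; apply: eq_bigr => i _.
  by rewrite mulr_sumr; apply: eq_bigr => j _; ring.
exact: sqr_ge0.
Qed.

(** Used twice: with a zero diagonal the right-hand side is affine in [t]; with [A i i > 0] its
    minimum over [t] is the form of a Schur complement. *)
Lemma quad_form_sub_delta {R : realType} {T : finType} (A : T -> T -> R)
    (v : T -> R) (i : T) (t : R) : (forall i j, A i j = A j i) ->
  \sum_a \sum_b (v a - t * (i == a)%:R) * A a b * (v b - t * (i == b)%:R) =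
  \sum_a \sum_b v a * A a b * v b - t * 2 * (\sum_a v a * A a i)
    + t ^+ 2 * A i i.
Proof.
move=> As.
have E (w w' : T -> R) : \sum_a \sum_b w a * A a b * w' b
    = \sum_a w a * \sum_b w' b * A a b.
  apply: eq_bigr => a _; rewrite mulr_sumr; apply: eq_bigr => b _.
  by rewrite -mulrA [A a b * _]mulrC.
have L (w : T -> R) F : \sum_a (w a - t * (i == a)%:R) * F a
    = \sum_a w a * F a - t * F i.
  rewrite -[X in _ = _ - t * X](sum_delta i F) mulr_sumr -sumrB.
  by apply: eq_bigr => a _; ring.
rewrite E L L.
have -> : \sum_a v a * \sum_b (v b - t * (i == b)%:R) * A a b
  = \sum_a \sum_b v a * A a b * v b - t * (\sum_a v a * A a i).
  rewrite E mulr_sumr -sumrB; apply: eq_bigr => a _; rewrite L; ring.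
have -> : \sum_b v b * A i b = \sum_b v b * A b i.
  by apply: eq_bigr => b _; rewrite As.
ring.
Qed.

Lemma psd_zero_diag {R : realType} {T : finType} (A : T -> T -> R) :
  fpsd A -> (forall i, A i i = 0) -> forall i j, A i j = 0.
Proof.
move=> [As Ap] A0 i j; pose v := fun a => (j == a)%:R : R.
(* Along [e_j - t e_i] the form is linear in [t], so nonnegativity at [t = 1] and [t = -1] forces
   the slope to vanish. *)
have H t : 0 <= - t * 2 * A j i.
  have := Ap (fun a => v a - t * (i == a)%:R).
  rewrite quad_form_sub_delta // A0 mulr0 addr0.
  rewrite (sum_delta j (fun a => A a i)).
  have -> : \sum_a \sum_b v a * A a b * v b = 0.
    transitivity (\sum_a (j == a)%:R * \sum_b (j == b)%:R * A a b).
      apply: eq_bigr => a _; rewrite mulr_sumr; apply: eq_bigr => b _.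
      by rewrite /v; ring.
    by rewrite (sum_delta j (fun a => \sum_b (j == b)%:R * A a b))
      (sum_delta j (A j)) A0.
  by rewrite sub0r !mulNr.
have H1 := H 1; have H2 := H (-1); rewrite As; lra.
Qed.

(* Subtracting the rank-one matrix A e_i e_i^T A / A_ii (a Schur complement)
   keeps A positive semidefinite and lowers its rank. *)
Lemma psd_factor {R : realType} {n : nat} (k : nat) (A : 'M[R]_n) :
  psdmx A -> (\rank A <= k)%N -> exists F : 'M[R]_(n, k), A = F *m F^T.
Proof.
elim: k A => [|k IHk] A Apsd rA.
  exists 0; rewrite mul0mx; apply/eqP.
  by rewrite -mxrank_eq0 -leqn0.
have [/forallP A0|] := boolP [forall i, A i i == 0].
  exists 0; rewrite mul0mx; apply/matrixP => i j; rewrite mxE.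
  by apply: (psd_zero_diag _ Apsd) => l; apply/eqP.
rewrite negb_forall => /existsP[i Ai0].
have [As Ap] := Apsd.
have Aii : 0 < A i i.
  rewrite lt_neqAle eq_sym Ai0 /=.
  have := Ap (fun a => (i == a)%:R).
  under eq_bigr => a _ do (under eq_bigr => b _ do rewrite -mulrA;
    rewrite -mulr_sumr; under eq_bigr => b _ do rewrite mulrC).
  by rewrite (sum_delta i (fun a => \sum_b (i == b)%:R * A a b))
      (sum_delta i (A i)).
set r := Num.sqrt (A i i).
have r0 : 0 < r by rewrite sqrtr_gt0.
have rr : r * r = A i i by rewrite -expr2 sqr_sqrtr // ltW.
pose x : 'cV[R]_n := \col_j (A j i / r).
pose B := A - x *m x^T.
have BE a b : B a b = A a b - A a i * A b i / A i i.
  rewrite !mxE big_ord1 !mxE -rr; congr (_ - _); field; exact: lt0r_neq0.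
have Bpsd : psdmx B.
  split=> [a b|v]; first by rewrite !BE As [A a i * _]mulrC.
  (* This [t] minimises the form of [A] on the line [v - t e_i]; the minimum is the form of [B] at
     [v]. *)
  pose t := (\sum_a v a * A a i) / A i i.
  have := Ap (fun a => v a - t * (i == a)%:R); rewrite quad_form_sub_delta //.
  congr (_ <= _).
  have -> : \sum_a \sum_b v a * B a b * v b =
     \sum_a \sum_b v a * A a b * v b - (\sum_a v a * A a i) ^+ 2 / A i i.
    rewrite expr2 mulrAC mulr_suml mulr_suml -sumrB; apply: eq_bigr => a _.
    rewrite mulr_sumr -sumrB; apply: eq_bigr => b _; rewrite BE.
    by field.
  by rewrite /t; field.
(* [B] is a left multiple of [A], so its row space lies in that of [A]. The inclusion is strict
   because [B] kills [e_i], whereas [A e_i] has the nonzero entry [A i i]. *)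
have rB : (\rank B < \rank A)%N.
  apply: rank_ltmx; rewrite /ltmx; apply/andP; split.
    have -> : B = (1%:M - x *m (delta_mx ord0 i : 'rV_n) *m
                (r^-1)%:M) *m A.
      apply/matrixP => a b; rewrite BE mulmxBl mul1mx !mxE; congr (_ - _).
      rewrite (bigD1 i) //= big1 ?addr0 => [|l li].
        rewrite mul_mx_scalar !mxE big_ord1 !mxE !eqxx /= mulr1 -rr As.
        by rewrite [A b i]As; field; exact: lt0r_neq0.
      rewrite mul_mx_scalar !mxE big_ord1 !mxE (negPf li) andbF.
      by rewrite mulr0 mulr0 mul0r.
    exact: submxMl.
  apply/negP => /submxP[C AC].
  have : (A *m (delta_mx i ord0 : 'cV_n)) i ord0 = 0.
    rewrite AC -mulmxA.
    have -> : B *m (delta_mx i ord0 : 'cV_n) = 0.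
      apply/matrixP => a b; rewrite !mxE (bigD1 i) //= big1 ?addr0 => [|l li].
        rewrite BE !mxE eqxx (ord1 b) eqxx mulr1 mulfK ?subrr //.
      by rewrite !mxE (negPf li) mulr0.
    by rewrite mulmx0 mxE.
  rewrite mxE (bigD1 i) //= big1 ?addr0 => [|l li].
    by rewrite !mxE !eqxx mulr1 => /eqP; rewrite (negPf Ai0).
  by rewrite !mxE (negPf li) mulr0.
have [|F BF] := IHk B Bpsd; first by rewrite -ltnS; exact: leq_trans rA.
have -> : A = row_mx x F *m (row_mx x F)^T.
  by rewrite tr_row_mx mul_row_col -BF /B addrC subrK.
by exists (row_mx x F).
Qed.

(** * Permutations and concatenation of indices *)

Definition permi {T : finType} {M : nat} (s : {perm 'I_M})
  (a : {ffun 'I_M -> T}) : {ffun 'I_M -> T} := [ffun i => a (s i)].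

Lemma permiM {T : finType} {M : nat} (s t : {perm 'I_M})
    (a : {ffun 'I_M -> T}) : permi s (permi t a) = permi (s * t)%g a.
Proof. by apply/ffunP => i; rewrite !ffunE permM. Qed.

Lemma permi1 {T : finType} {M : nat} (a : {ffun 'I_M -> T}) : permi 1%g a = a.
Proof. by apply/ffunP => i; rewrite !ffunE perm1. Qed.

Lemma permiK {T : finType} {M : nat} (s : {perm 'I_M}) :
  cancel (@permi T M s) (permi s^-1%g).
Proof. by move=> a; rewrite permiM mulVg permi1. Qed.

Lemma permiKV {T : finType} {M : nat} (s : {perm 'I_M}) :
  cancel (@permi T M s^-1%g) (permi s).
Proof. by move=> a; rewrite permiM mulgV permi1. Qed.

Lemma eq_permi {T : finType} {M : nat} (s : {perm 'I_M})
    (a b : {ffun 'I_M -> T}) : (a == permi s b) = (permi s^-1%g a == b).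
Proof. by apply/eqP/eqP => [->|<-]; rewrite ?permiK ?permiKV. Qed.

Section Join.
Context {n k N : nat}.
Implicit Types (p : Pty n k) (r : Rest n k N) (a : Idx n k N).

Lemma join0 p r : join p r ord0 = p.
Proof. by rewrite ffunE unlift_none. Qed.

Lemma join_lift p r j : join p r (lift ord0 j) = r j.
Proof. by rewrite ffunE liftK. Qed.

Lemma rest_join p r : rest (join p r) = r.
Proof. by apply/ffunP => j; rewrite ffunE join_lift. Qed.

Lemma join_rest a : join (a ord0) (rest a) = a.
Proof.
by apply/ffunP => i; rewrite ffunE; case: unliftP => [j ->|->] //; rewrite ffunE.
Qed.

Lemma setA_join p p' r : setA (join p r) p' = join p' r.
Proof.
apply/ffunP => i; rewrite ffunE; case: (unliftP ord0 i) => [j ->|->].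
  by rewrite -(inj_eq val_inj) /= !join_lift.
by rewrite eqxx join0.
Qed.

Lemma sum_join {V : nmodType} (F : Idx n k N -> V) :
  \sum_a F a = \sum_p \sum_r F (join p r).
Proof.
rewrite pair_bigA /= (reindex (fun u : Pty n k * Rest n k N => join u.1 u.2)) //=.
exists (fun a => (a ord0, rest a)) => [[p r] _|a _] /=.
  by rewrite join0 rest_join.
by rewrite join_rest.
Qed.

Lemma prod_join {R : comPzRingType} (f : Pty n k -> R) p r :
  \prod_t f (join p r t) = f p * \prod_j f (r j).
Proof.
rewrite big_ord_recl join0; congr (_ * _).
by apply: eq_bigr => j _; rewrite join_lift.
Qed.

End Join.

(** The extra party goes last, so that party A keeps the index [ord0] when the extra one is traced
    out. *)
Definition snoc {T : finType} {M : nat} (a : {ffun 'I_M -> T}) (q : T) :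
    {ffun 'I_M.+1 -> T} :=
  [ffun i => if unlift ord_max i is Some j then a j else q].

Lemma snoc_lift {T : finType} {M : nat} (a : {ffun 'I_M -> T}) q j :
  snoc a q (lift ord_max j) = a j.
Proof. by rewrite ffunE liftK. Qed.

Lemma snoc_max {T : finType} {M : nat} (a : {ffun 'I_M -> T}) q :
  snoc a q ord_max = q.
Proof. by rewrite ffunE unlift_none. Qed.

Lemma sum_snoc {T : finType} {M : nat} {V : nmodType}
    (F : {ffun 'I_M.+1 -> T} -> V) :
  \sum_a F a = \sum_a \sum_q F (snoc a q).
Proof.
rewrite pair_bigA /=.
rewrite (reindex (fun u : {ffun 'I_M -> T} * T => snoc u.1 u.2)) //=.
exists (fun a => ([ffun j => a (lift ord_max j)], a ord_max)) => [[a q] _|a _] /=.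
  rewrite snoc_max; congr (_, _).
  by apply/ffunP => j; rewrite ffunE snoc_lift.
apply/ffunP => i; case: (unliftP ord_max i) => [j ->|->].
  by rewrite snoc_lift ffunE.
by rewrite snoc_max.
Qed.

Lemma snoc_join {n k N : nat} (p : Pty n k) (r : Rest n k N) q :
  snoc (join p r) q = join p (snoc r q).
Proof.
apply/ffunP => i; case: (unliftP ord_max i) => [j ->|->].
  rewrite snoc_lift; case: (unliftP ord0 j) => [l ->|->].
    rewrite join_lift.
    have -> : lift ord_max (lift ord0 l) = lift ord0 (lift ord_max l).
      by apply/val_inj; rewrite /= /bump /= add1n ltnS [(N <= l)%N]leqNgt ltn_ord.
    by rewrite join_lift snoc_lift.
  have -> : lift ord_max (ord0 : 'I_N.+1) = ord0 by exact/val_inj.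
  by rewrite !join0.
rewrite snoc_max.
have -> : ord_max = lift ord0 (ord_max : 'I_N.+1) by exact/val_inj.
by rewrite join_lift snoc_max.
Qed.

Lemma snoc_permi {T : finType} {M : nat} (s : {perm 'I_M})
    (a : {ffun 'I_M -> T}) q :
  snoc (permi s a) q = permi (lift_perm ord_max ord_max s) (snoc a q).
Proof.
apply/ffunP => i; rewrite [RHS]ffunE; case: (unliftP ord_max i) => [j ->|->].
  by rewrite lift_perm_lift !snoc_lift ffunE.
by rewrite lift_perm_id !snoc_max.
Qed.

(** * Feasible points of the semidefinite program *)

Section Feasibility.
Context {R : realType} {n m k : nat}.

Lemma fmul_Psyml {N} (Phi : Idx n k N -> Idx n k N -> R) a b :
  fmul (@Psym R n k N) Phi a b
  = (N.+1)`!%:R^-1 * \sum_(s : {perm 'I_N.+1}) Phi (permi s a) b.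
Proof.
rewrite /fmul /Psym; under eq_bigr => l _ do rewrite -mulrA mulr_suml.
rewrite -mulr_sumr exchange_big /=; congr (_ * _).
rewrite [RHS](reindex_inj invg_inj) /=; apply: eq_bigr => s _.
rewrite -(sum_delta (permi s^-1%g a) (fun l => Phi l b)).
by apply: eq_bigr => l _; rewrite /Vperm -[ [ffun i => _] ]/(permi s l) eq_permi.
Qed.

Lemma fmul_Psymr {N} (Phi : Idx n k N -> Idx n k N -> R) a b :
  fmul Phi (@Psym R n k N) a b
  = (N.+1)`!%:R^-1 * \sum_(s : {perm 'I_N.+1}) Phi a (permi s b).
Proof.
rewrite /fmul /Psym; under eq_bigr => l _ do rewrite mulrCA mulr_sumr.
rewrite -mulr_sumr exchange_big /=; congr (_ * _); apply: eq_bigr => s _.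
rewrite -(sum_delta (permi s b) (fun l => Phi a l)).
by apply: eq_bigr => l _; rewrite /Vperm -[ [ffun i => _] ]/(permi s b) mulrC eq_sym.
Qed.

(** Sandwiching by the projector averages over independent permutations of the row and the column
    index; translating the group leaves such an average unchanged, and the average of a constant is
    that constant. *)
Lemma Psym_fixP {N} (Phi : Idx n k N -> Idx n k N -> R) :
  (forall a b, fmul (fmul (@Psym R n k N) Phi) (@Psym R n k N) a b = Phi a b) <->
  (forall s t a b, Phi (permi s a) (permi t b) = Phi a b).
Proof.
have E a b : fmul (fmul (@Psym R n k N) Phi) (@Psym R n k N) a b =
   (N.+1)`!%:R^-1 * \sum_t ((N.+1)`!%:R^-1 * \sum_s Phi (permi s a) (permi t b)).
  by rewrite fmul_Psymr; congr (_ * _); apply: eq_bigr => t _; rewrite fmul_Psyml.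
split=> [H s t a b|H a b].
  rewrite -[LHS]H -[RHS]H !E; congr (_ * _).
  rewrite [RHS](reindex_inj (mulIg t)) /=; apply: eq_bigr => t' _; congr (_ * _).
  rewrite [RHS](reindex_inj (mulIg s)) /=; apply: eq_bigr => s' _.
  by rewrite !permiM.
have F0 : (N.+1)`!%:R != 0 :> R by rewrite pnatr_eq0 -lt0n fact_gt0.
have S : forall c : R, (N.+1)`!%:R^-1 * (\sum_(s : {perm 'I_N.+1}) c) = c.
  move=> c; rewrite sumr_const; have -> := card_Sn N.+1.
  by rewrite -[c *+ _]mulr_natl mulKf.
rewrite E -[RHS]S; congr (_ * _); apply: eq_bigr => t _.
by rewrite -[RHS]S; congr (_ * _); apply: eq_bigr => s _.
Qed.

Lemma sum_pty (F : Pty n k -> R) : \sum_p F p = \sum_i \sum_l F (i, l).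
Proof. by rewrite pair_bigA; apply: eq_bigr => -[]. Qed.

(** The reduced state of party A: the partial trace over all the other parties. *)
Definition redA {N} (Phi : Idx n k N -> Idx n k N -> R) (p p' : Pty n k) : R :=
  \sum_r Phi (join p r) (join p' r).

(** The partial trace is adjoint to tensoring with the identity. *)
Lemma Xt_tr2 (X : 'M[R]_n) (sigma : Pty n k -> Pty n k -> R) :
  \sum_p \sum_p' Xt X p p' * sigma p' p = \tr (X *m tr2 sigma).
Proof.
rewrite /mxtrace; under [RHS]eq_bigr => i _ do rewrite mxE.
rewrite sum_pty.
apply: eq_bigr => i _.
transitivity (\sum_l \sum_j X i j * sigma (j, l) (i, l)).
  apply: eq_bigr => l _.
  rewrite sum_pty.
  apply: eq_bigr => j _; rewrite -(sum_delta l (fun l' => sigma (j, l') (i, l))).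
  by rewrite mulr_sumr; apply: eq_bigr => l' _; rewrite /Xt /fkron /fid /= mulrA.
rewrite exchange_big; apply: eq_bigr => j _.
by rewrite mxE mulr_sumr.
Qed.

Lemma ftr_XA (X : 'M[R]_n) {N} (Phi : Idx n k N -> Idx n k N -> R) :
  ftr (fmul (@XA R n k X N) Phi) = \tr (X *m tr2 (redA Phi)).
Proof.
rewrite -Xt_tr2 /ftr /fmul sum_join; apply: eq_bigr => p _.
transitivity (\sum_r \sum_p' Xt X p p' * Phi (join p' r) (join p r)).
  apply: eq_bigr => r _; rewrite sum_join; apply: eq_bigr => p' _.
  rewrite -(sum_delta r (fun r' => Phi (join p' r') (join p r))) mulr_sumr.
  by apply: eq_bigr => r' _; rewrite /XA /fid !join0 !rest_join mulrA.
by rewrite exchange_big; apply: eq_bigr => p' _; rewrite mulr_sumr.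
Qed.

Lemma tr2_sum (I : finType) (sigma : I -> Pty n k -> Pty n k -> R) :
  tr2 (fun p p' => \sum_q sigma q p p') = \sum_q tr2 (sigma q).
Proof.
apply/matrixP => i j; rewrite mxE summxE exchange_big.
by apply: eq_bigr => q _; rewrite mxE.
Qed.

Lemma tr2_scale (c : R) (sigma : Pty n k -> Pty n k -> R) :
  tr2 (fun p p' => c * sigma p p') = c *: tr2 sigma.
Proof. by apply/matrixP => i j; rewrite !mxE mulr_sumr. Qed.

(** The constraints entry by entry: the partial transpose swaps the row and column index of party A,
    and the linear constraint is read block by block in the indices of the other parties. *)
Lemma sdp_feasibleP (Lam : {linear 'M[R]_n -> 'M[R]_m}) (Y : 'M[R]_m) {N}
    (Phi : Idx n k N -> Idx n k N -> R) :
  sdp_feasible Lam Y Phi <->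
  [/\ fpsd Phi, ftr Phi = 1,
    forall s t a b, Phi (permi s a) (permi t b) = Phi a b,
    forall p p' r r', Phi (join p' r) (join p r') = Phi (join p r) (join p' r') &
    forall r r', Lam (tr2 (fun p p' => Phi (join p r) (join p' r')))
                 = (\sum_p Phi (join p r) (join p r')) *: Y].
Proof.
split=> [[Hpsd [Htr [Hsym [Hpt HL]]]]|[Hpsd Htr Hsym Hpt HL]].
  split=> //; first exact/Psym_fixP.
    move=> p p' r r'; rewrite -[RHS]Hpt /ptA !join0 !setA_join //.
  move=> r r'; apply/matrixP => i j; have := HL (i, r) (j, r').
  by rewrite /LtA /Lt /= => ->; rewrite !mxE mulrC.
do 2!split=> //; split; first exact/Psym_fixP.
split=> [a b|[i r] [j r']].
  rewrite -[a]join_rest -[b]join_rest; set p := a ord0; set p' := b ord0.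
  by rewrite /ptA !join0 !setA_join Hpt.
by rewrite /LtA /Lt /= HL mxE mulrC.
Qed.

Lemma xi_val_le_xiSDP (X : 'M[R]_n) (Lam : {linear 'M[R]_n -> 'M[R]_m})
    (Y : 'M[R]_m) (N : nat) : (xi_val k X Lam Y <= xiSDP k X Lam Y N)%E.
Proof.
apply: ge_ereal_sup => _ [rho [Lrho [trrho [rpsd rrank]]] <-].
apply: le_ereal_sup_tmp.
have [F rhoF] := psd_factor k rho rpsd rrank.
pose phi (p : Pty n k) : R := F p.1 p.2.
have tr2phi : tr2 (fun p p' => phi p * phi p') = rho.
  rewrite rhoF; apply/matrixP => i j; rewrite !mxE.
  by apply: eq_bigr => l _; rewrite mxE.
have phi1 : \sum_p phi p * phi p = 1.
  rewrite -trrho -tr2phi /mxtrace.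
  rewrite sum_pty.
  by apply: eq_bigr => i _; rewrite mxE.
(* Needed for two values of [M]: all [N.+1] parties for the trace, and the [N] parties other than A
   for the marginal. *)
have Q1 M : \sum_(a : {ffun 'I_M -> Pty n k})
    (\prod_t phi (a t)) * (\prod_t phi (a t)) = 1.
  under eq_bigr => a _ do rewrite -big_split /=.
  rewrite -(bigA_distr_bigA (fun (t : 'I_M) p => phi p * phi p)) /=.
  by rewrite big1 // => t _.
pose Phi (a b : Idx n k N) : R := (\prod_t phi (a t)) * (\prod_t phi (b t)).
exists (ftr (fmul (@XA R n k X N) Phi))%:E; last first.
  rewrite lee_fin ftr_XA.
  suff -> : redA Phi = fun p p' => phi p * phi p' by rewrite tr2phi.
  apply/funext => p; apply/funext => p'.
  rewrite /redA -[RHS]mulr1 -(Q1 N) mulr_sumr; apply: eq_bigr => r _.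
  by rewrite /Phi !prod_join mulrACA.
exists Phi => //; apply/sdp_feasibleP; split.
- exact: fpsd_outer.
- exact: Q1.
- move=> s t a b; rewrite /Phi; congr (_ * _).
    rewrite [RHS](reindex_inj (@perm_inj _ s)) /=.
    by apply: eq_bigr => i _; rewrite ffunE.
  rewrite [RHS](reindex_inj (@perm_inj _ t)) /=.
  by apply: eq_bigr => i _; rewrite ffunE.
- by move=> p p' r r'; rewrite /Phi !prod_join; ring.
- move=> r r'; set q := (\prod_j phi (r j)) * (\prod_j phi (r' j)).
  have E p p' : Phi (join p r) (join p' r') = q * (phi p * phi p').
    by rewrite /Phi !prod_join /q; ring.
  under eq_bigr => p _ do rewrite E.
  rewrite -mulr_sumr phi1 mulr1.
  have -> : (fun p p' => Phi (join p r) (join p' r')) =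
            (fun p p' => q * (phi p * phi p')).
    by apply/funext => p; apply/funext => p'; rewrite E.
  by rewrite tr2_scale linearZ /= tr2phi Lrho.
Qed.

Lemma xiSDP_nonincreasing (X : 'M[R]_n) (Lam : {linear 'M[R]_n -> 'M[R]_m})
    (Y : 'M[R]_m) (N : nat) : (xiSDP k X Lam Y N.+1 <= xiSDP k X Lam Y N)%E.
Proof.
apply: ge_ereal_sup => _ [Phi /sdp_feasibleP[Hpsd Htr Hsym Hpt HL] <-].
apply: le_ereal_sup_tmp.
pose Psi (a b : Idx n k N) : R := \sum_q Phi (snoc a q) (snoc b q).
exists (ftr (fmul (@XA R n k X N) Psi))%:E; last first.
  rewrite lee_fin !ftr_XA.
  suff -> : redA Phi = redA Psi by [].
  apply/funext => p; apply/funext => p'; rewrite /redA sum_snoc.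
  by apply: eq_bigr => r _; apply: eq_bigr => q _; rewrite !snoc_join.
exists Psi => //; apply/sdp_feasibleP; split.
- by apply: fpsd_sum => q; exact: (fpsd_comp (fun a => snoc a q)).
- by rewrite -Htr /ftr [RHS]sum_snoc.
- by move=> s t a b; apply: eq_bigr => q _; rewrite !snoc_permi Hsym.
- by move=> p p' r r'; apply: eq_bigr => q _; rewrite !snoc_join Hpt.
- move=> r r'.
  have -> : tr2 (fun p p' => Psi (join p r) (join p' r')) = \sum_q
     tr2 (fun p p' => Phi (join p (snoc r q)) (join p' (snoc r' q))).
    rewrite -tr2_sum; congr (tr2 _); apply/funext => p; apply/funext => p'.
    by apply: eq_bigr => q _; rewrite !snoc_join.
  rewrite linear_sum /= exchange_big /= scaler_suml; apply: eq_bigr => q _.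
  by rewrite HL; congr (_ *: _); apply: eq_bigr => p _; rewrite !snoc_join.
Qed.

End Feasibility.

(** * The distribution of measurement outcomes *)

Definition upd {T : finType} {M : nat} (a : {ffun 'I_M -> T}) (t : 'I_M)
  (x : T) : {ffun 'I_M -> T} := [ffun i => if i == t then x else a i].

(* (a, x) |-> (upd a t x, a t) is an involution. *)
Lemma sum_upd {R : pzRingType} {T : finType} {M : nat} (t : 'I_M)
    (G : {ffun 'I_M -> T} -> R) :
  \sum_a \sum_x G (upd a t x) = (\sum_a G a) *+ #|T|.
Proof.
pose h (u : {ffun 'I_M -> T} * T) := (upd u.1 t u.2, u.1 t).
have hK : involutive h.
  move=> [a x]; rewrite /h /= ffunE eqxx; congr (_, _).
  by apply/ffunP => i; rewrite !ffunE; case: eqP => // ->.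
rewrite pair_bigA /= -sumrMnl.
transitivity (\sum_(u : {ffun 'I_M -> T} * T) G u.1).
  by rewrite [RHS](reindex_inj (inv_inj hK)).
rewrite -(pair_bigA _ (fun a (x : T) => G a)) /=.
by apply: eq_bigr => a _; rewrite sumr_const.
Qed.

Definition upd2 {T : finType} {M : nat} (t t' : 'I_M) (a : {ffun 'I_M -> T})
  (v : T * T) : {ffun 'I_M -> T} := upd (upd a t v.1) t' v.2.

(** Resampling coordinates [t] and [t'] counts every configuration [#|T|] squared times, so it is
    enough that the sum over these two coordinates vanishes for each choice of the others. *)
Lemma sum_upd2_eq0 {R : numDomainType} {T : finType} {M : nat} (t t' : 'I_M)
    (G : {ffun 'I_M -> T} -> R) :
  (forall a, \sum_v G (upd2 t t' a v) = 0) -> \sum_a G a = 0.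
Proof.
move=> H.
have : (\sum_a G a) *+ #|T| *+ #|T| = 0.
  rewrite -(sum_upd t') -(sum_upd t); apply: big1 => a _.
  by rewrite pair_bigA /=; exact: H.
move=> /eqP; rewrite !mulrn_eq0 orbA orbb => /orP[/eqP T0|/eqP //].
(* If [T] is empty there is no configuration at all, since [a t] would be an element of [T]. *)
apply: big1 => a _; exfalso.
by have := card0_eq T0 (a t); rewrite inE.
Qed.

Section Expectation.
Context {R : realType} {T S : finType} {M : nat}.
Variables (E : S -> T -> T -> R) (Phi : {ffun 'I_M -> T} -> {ffun 'I_M -> T} -> R).
Implicit Types (a b : {ffun 'I_M -> T}) (s : {ffun 'I_M -> S}).

(* Outcome distribution when every party is measured with the POVM E. *)
Definition outcome s : R := \sum_a \sum_b Phi a b * \prod_t E (s t) (a t) (b t).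

(** Rank-one effects make the probability of [s] equal to [c ^+ M] times the quadratic form of [Phi]
    at a product vector. *)
Lemma outcome_ge0 (u : S -> T -> R) (c : R) :
  (forall o x y, E o x y = c * (u o x * u o y)) -> 0 <= c -> fpsd Phi ->
  forall s, 0 <= outcome s.
Proof.
move=> Eu c0 [_ Ppos] s.
have -> : outcome s = c ^+ M *
   \sum_(a : {ffun 'I_M -> T}) \sum_(b : {ffun 'I_M -> T})
   (\prod_t u (s t) (a t)) * Phi a b * (\prod_t u (s t) (b t)).
  rewrite mulr_sumr; apply: eq_bigr => a _; rewrite mulr_sumr.
  apply: eq_bigr => b _.
  under eq_bigr => t _ do rewrite Eu.
  rewrite !big_split /= prodr_const card_ord; ring.
by rewrite mulr_ge0 ?exprn_ge0.
Qed.

Lemma outcome_permi (p : {perm 'I_M}) :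
  (forall a b, Phi (permi p a) (permi p b) = Phi a b) ->
  forall s, outcome (permi p s) = outcome s.
Proof.
move=> H s; rewrite /outcome (reindex_inj (can_inj (permiK p))) /=.
apply: eq_bigr => a _; rewrite (reindex_inj (can_inj (permiK p))) /=.
apply: eq_bigr => b _; rewrite H; congr (_ * _).
rewrite [RHS](reindex_inj (@perm_inj _ p)) /=.
by apply: eq_bigr => t _; rewrite !ffunE.
Qed.

(** With the outcomes and indices of all other parties fixed, their factors and [psi] are constants;
    what remains is the sum over parties [t] and [t'], which is zero by hypothesis. *)
Lemma expect_vanish (t t' : 'I_M) (kap : S -> S -> R)
    (psi : {ffun 'I_M -> S} -> R) :
  t != t' -> (forall s v, psi (upd2 t t' s v) = psi s) ->
  (forall a b, \sum_(w : T * T) \sum_(v : T * T) (\sum_(o : S * S)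
      kap o.1 o.2 * (E o.1 v.1 w.1 * E o.2 v.2 w.2)) *
      Phi (upd2 t t' a v) (upd2 t t' b w) = 0) ->
  \sum_s outcome s * (kap (s t) (s t') * psi s) = 0.
Proof.
move=> tt' Hpsi HPhi.
have atT (U : finType) (a : {ffun 'I_M -> U}) v : upd2 t t' a v t = v.1.
  by rewrite !ffunE eqxx (negPf tt').
have atT' (U : finType) (a : {ffun 'I_M -> U}) v : upd2 t t' a v t' = v.2.
  by rewrite !ffunE eqxx.
have atO (U : finType) (a : {ffun 'I_M -> U}) v i : i != t -> i != t' ->
    upd2 t t' a v i = a i.
  by rewrite !ffunE => /negPf -> /negPf ->.
apply: (sum_upd2_eq0 t t') => s.
under eq_bigr => o _ do rewrite mulr_suml.
rewrite exchange_big /=; apply: (sum_upd2_eq0 t t') => a.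
under eq_bigr => v _ do under eq_bigr => o _ do rewrite mulr_suml.
under eq_bigr => v _ do rewrite exchange_big /=.
rewrite exchange_big /=; apply: (sum_upd2_eq0 t t') => b.
transitivity ((\prod_(i | (i != t) && (i != t')) E (s i) (a i) (b i)) * psi s *
   0); last by rewrite mulr0.
rewrite -[in RHS](HPhi a b) mulr_sumr; apply: eq_bigr => w _.
rewrite mulr_sumr; apply: eq_bigr => v _.
rewrite mulr_suml mulr_sumr; apply: eq_bigr => o _.
rewrite Hpsi !atT !atT' (bigD1 t) //= (bigD1 t') /= 1?eq_sym //.
rewrite !atT !atT'.
under eq_bigr => i /andP[it it'] do rewrite !atO //.
ring.
Qed.

(* At most 5 M^3 quadruples of parties are not covered by the last hypothesis. *)
Lemma second_moment_bound (P : {ffun 'I_M -> S} -> R) (kap : S -> S -> R)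
    (B : R) :
  (0 < M)%N -> (forall s, 0 <= P s) -> \sum_s P s = 1 ->
  (forall o o', `|kap o o'| <= B) ->
  (forall t1 t2 t3 t4 : 'I_M, t1 != t2 -> t3 != t1 -> t3 != t2 -> t4 != t1 ->
     t4 != t2 ->
     \sum_s P s * (kap (s t1) (s t2) * kap (s t3) (s t4)) = 0) ->
  \sum_s P s * (M%:R ^- 2 * \sum_t \sum_t' kap (s t) (s t')) ^+ 2
    <= 5 * B ^+ 2 / M%:R.
Proof.
move=> M0 P0 P1 Bk Hv.
have Mr : M%:R != 0 :> R by rewrite pnatr_eq0 -lt0n.
pose e t1 t2 t3 t4 := \sum_s P s * (kap (s t1) (s t2) * kap (s t3) (s t4)).
have -> : \sum_s P s * (M%:R ^- 2 * \sum_t \sum_t' kap (s t) (s t')) ^+ 2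
   = M%:R ^- 4 * \sum_t1 \sum_t2 \sum_t3 \sum_t4 e t1 t2 t3 t4.
  rewrite /e mulr_sumr.
  under [RHS]eq_bigr => t1 _.
    under eq_bigr => t2 _.
      under eq_bigr => t3 _ do rewrite exchange_big /=.
      rewrite exchange_big /=.
    over.
    rewrite exchange_big /= mulr_sumr.
  over.
  rewrite [RHS]exchange_big /=; apply: eq_bigr => s _.
  rewrite -mulr_sumr.
  have -> : \sum_t1 \sum_t2 \sum_t3 \sum_t4
      P s * (kap (s t1) (s t2) * kap (s t3) (s t4)) =
      P s * (\sum_t \sum_t' kap (s t) (s t')) ^+ 2.
    rewrite expr2 mulr_suml mulr_sumr; apply: eq_bigr => t1 _.
    rewrite mulr_suml mulr_sumr; apply: eq_bigr => t2 _.
    rewrite mulr_sumr mulr_sumr; apply: eq_bigr => t3 _.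
    by rewrite mulr_sumr mulr_sumr.
  by field.
pose d (i j : 'I_M) : R := (i == j)%:R.
(* Every quadruple outside the vanishing case satisfies one of five equalities, so a sum of five
   indicators dominates; the equality [t3 = t4] is not among them. *)
have ebound t1 t2 t3 t4 : e t1 t2 t3 t4 <=
    B ^+ 2 * (d t1 t2 + d t3 t1 + d t3 t2 + d t4 t1 + d t4 t2).
  have eB : e t1 t2 t3 t4 <= B ^+ 2.
    rewrite -[leRHS]mul1r -P1 mulr_suml; apply: ler_sum => s _.
    apply: ler_wpM2l => //; apply: le_trans (ler_norm _) _.
    by rewrite normrM expr2 ler_pM.
  have B2 : 0 <= B ^+ 2 by exact: sqr_ge0.
  have d0 i j : 0 <= d i j by rewrite ler0n.
  have big i j : i == j -> d i j = 1 by rewrite /d => ->.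
  have [/big E1|n1] := boolP (t1 == t2).
    by rewrite E1; apply: le_trans eB _; rewrite ler_peMr // -!addrA lerDl !addr_ge0.
  have [/big E1|n2] := boolP (t3 == t1).
    rewrite E1; apply: le_trans eB _; rewrite ler_peMr //.
    have := d0 t1 t2; have := d0 t3 t2; have := d0 t4 t1; have := d0 t4 t2; lra.
  have [/big E1|n3] := boolP (t3 == t2).
    rewrite E1; apply: le_trans eB _; rewrite ler_peMr //.
    have := d0 t1 t2; have := d0 t3 t1; have := d0 t4 t1; have := d0 t4 t2; lra.
  have [/big E1|n4] := boolP (t4 == t1).
    rewrite E1; apply: le_trans eB _; rewrite ler_peMr //.
    have := d0 t1 t2; have := d0 t3 t2; have := d0 t3 t1; have := d0 t4 t2; lra.
  have [/big E1|n5] := boolP (t4 == t2).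
    rewrite E1; apply: le_trans eB _; rewrite ler_peMr //.
    have := d0 t1 t2; have := d0 t3 t2; have := d0 t3 t1; have := d0 t4 t1; lra.
  by rewrite /e Hv // mulr_ge0 // !addr_ge0.
have D1 (i : 'I_M) : \sum_j d i j = 1.
  by rewrite -(sum_delta i (fun _ => 1)); apply: eq_bigr => j _; rewrite mulr1.
have D2 (j : 'I_M) : \sum_i d i j = 1.
  by rewrite -(D1 j); apply: eq_bigr => i _; rewrite /d eq_sym.
have C1 (c : R) : \sum_(i : 'I_M) c = M%:R * c.
  by rewrite sumr_const card_ord mulr_natl.
(* Each indicator sums to [M ^ 3] over the four indices, which against the prefactor [M ^ -4] leaves
   [5 / M]. *)
have -> : 5 * B ^+ 2 / M%:R = M%:R ^- 4 * (\sum_t1 \sum_t2 \sum_t3 \sum_t4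
    B ^+ 2 * (d t1 t2 + d t3 t1 + d t3 t2 + d t4 t1 + d t4 t2)).
  under [X in _ = _ * X]eq_bigr => t1 _.
    under eq_bigr => t2 _.
      under eq_bigr => t3 _.
        rewrite -mulr_sumr !big_split /= !D2 !C1.
      over.
      rewrite -mulr_sumr !big_split /= -!mulr_sumr !D2 !C1.
    over.
    rewrite -mulr_sumr !big_split /= -!mulr_sumr !D1 !C1.
  over.
  by rewrite -mulr_sumr !big_split /= -?mulr_sumr !C1; field.
apply: ler_wpM2l; first by rewrite invr_ge0 exprn_ge0.
by do 4!(apply: ler_sum => ? _).
Qed.

End Expectation.

(** * Expectations of a single outcome and the reduced state *)

Section FirstMarginal.
Context {R : realType} {n k N : nat} {S : finType}.
Variables (E : S -> Pty n k -> Pty n k -> R) (Phi : Idx n k N -> Idx n k N -> R).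
Hypothesis E1 : forall x y, \sum_o E o x y = (x == y)%:R.

Lemma expect_first (f : S -> R) :
  \sum_s outcome E Phi s * f (s ord0) =
  \sum_p \sum_p' (\sum_o f o * E o p p') * redA Phi p p'.
Proof.
(* Writing [f (s ord0)] as a product over the parties makes the sum over [s] factorise; by [E1]
   every party other than A then contributes a delta, which traces it out. *)
pose F (t : 'I_N.+1) (o : S) : R := if t == ord0 then f o else 1.
have prodF (s : {ffun 'I_N.+1 -> S}) : \prod_t F t (s t) = f (s ord0).
  by rewrite big_ord_recl big1 ?mulr1.
have W (a b : Idx n k N) : \sum_(s : {ffun 'I_N.+1 -> S})
    (\prod_t E (s t) (a t) (b t)) * f (s ord0)
    = (\sum_o f o * E o (a ord0) (b ord0)) * (rest a == rest b)%:R.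
  under eq_bigr => s _ do rewrite -prodF mulrC -big_split /=.
  rewrite -(bigA_distr_bigA (fun t o => F t o * E o (a t) (b t))) /=.
  rewrite big_ord_recl; congr (_ * _).
  transitivity (\prod_(i < N) (a (lift ord0 i) == b (lift ord0 i))%:R : R).
    by apply: eq_bigr => i _; rewrite -E1; apply: eq_bigr => o _; rewrite mul1r.
  have [/ffunP re|/eqP ne] := eqVneq (rest a) (rest b).
    by rewrite big1 // => i _; have := re i; rewrite !ffunE => ->; rewrite eqxx.
  have [i ni] : exists i, a (lift ord0 i) != b (lift ord0 i).
    apply/existsP; apply: contra_notT ne; rewrite negb_exists => /forallP H.
    by apply/ffunP => i; rewrite !ffunE; apply/eqP; rewrite -[_ == _]negbK.
  by rewrite (bigD1 i) //= (negPf ni) mul0r.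
transitivity (\sum_a \sum_b Phi a b *
   ((\sum_o f o * E o (a ord0) (b ord0)) * (rest a == rest b)%:R)).
  under eq_bigr => s _ do rewrite mulr_suml.
  rewrite exchange_big /=; apply: eq_bigr => a _.
  under eq_bigr => s _ do rewrite mulr_suml.
  rewrite exchange_big /=; apply: eq_bigr => b _.
  by rewrite -W mulr_sumr; apply: eq_bigr => s _; rewrite mulrA.
rewrite sum_join; apply: eq_bigr => p _.
transitivity (\sum_r \sum_p' (\sum_o f o * E o p p') * Phi (join p r) (join p' r)).
  apply: eq_bigr => r _; rewrite sum_join; apply: eq_bigr => p' _.
  rewrite -(sum_delta r (fun r' => Phi (join p r) (join p' r'))) mulr_sumr.
  by apply: eq_bigr => r' _; rewrite !join0 !rest_join; ring.
by rewrite exchange_big; apply: eq_bigr => p' _; rewrite mulr_sumr.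
Qed.

Lemma outcome_sum1 : ftr Phi = 1 -> \sum_s outcome E Phi s = 1.
Proof.
move=> <-.
transitivity (\sum_s outcome E Phi s * (fun _ => 1) (s ord0)).
  by apply: eq_bigr => s _; rewrite mulr1.
rewrite (expect_first (fun=> 1)) /ftr sum_join; apply: eq_bigr => p _.
rewrite -/(redA Phi p p) -(sum_delta p (redA Phi p)).
apply: eq_bigr => p' _; rewrite -E1; congr (_ * _).
by apply: eq_bigr => o _; rewrite mul1r.
Qed.

Lemma expect_any (f : S -> R) (t : 'I_N.+1) :
  (forall s t a b, Phi (permi s a) (permi t b) = Phi a b) ->
  \sum_s outcome E Phi s * f (s t) =
  \sum_p \sum_p' (\sum_o f o * E o p p') * redA Phi p p'.
Proof.
move=> H; rewrite -expect_first.
rewrite (reindex_inj (can_inj (permiK (tperm ord0 t)))) /=.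
by apply: eq_bigr => s _; rewrite outcome_permi // ffunE tpermR.
Qed.

End FirstMarginal.

(** * The frame and the limit *)

Section Frame.
Context {R : realType} {T : finType}.
Implicit Types (o : T * T * bool) (x y i j : T).

(** The vector [e_i + e_j] or [e_i - e_j] for [o = (i, j, b)]. Equal indices are allowed and give
    [2 e_i] or 0. *)
Definition frame_vec o x : R :=
  (x == o.1.1)%:R + (-1) ^+ o.2 * (x == o.1.2)%:R.

Definition frame_E o x y : R :=
  (4 * #|T|%:R)^-1 * (frame_vec o x * frame_vec o y).

(* The frame dual to [frame_E] on symmetric matrices; the multiple of the
   identity, which integrates to 0 against [frame_E], normalises the trace. *)
Definition frame_D o x y : R :=
  (-1) ^+ o.2 * #|T|%:R * ((x == o.1.1)%:R * (y == o.1.2)%:R)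
  + (1 - (-1) ^+ o.2 * #|T|%:R * (o.1.1 == o.1.2)%:R) / #|T|%:R * (x == y)%:R.

(** The kernel of the symmetrisation map sending [A] to the mean of [A] and its transpose. *)
Definition symdelta i j x y : R :=
  ((i == x)%:R * (j == y)%:R + (j == x)%:R * (i == y)%:R) / 2.

Hypothesis T0 : (0 < #|T|)%N.
Let d0 : #|T|%:R != 0 :> R. Proof. by rewrite pnatr_eq0 -lt0n. Qed.

Lemma sum_frame (F : T * T * bool -> R) :
  \sum_o F o = \sum_i \sum_j (F (i, j, false) + F (i, j, true)).
Proof.
transitivity (\sum_(p : T * T) \sum_b F (p, b)).
  by rewrite pair_bigA; apply: eq_bigr => -[].
by rewrite [RHS]pair_bigA; apply: eq_bigr => -[i j] _; rewrite big_bool /= addrC.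
Qed.

Lemma sum_delta2 x y : \sum_i (x == i)%:R * (y == i)%:R = (x == y)%:R :> R.
Proof. by rewrite (sum_delta x (fun i => (y == i)%:R)) eq_sym. Qed.

Lemma sum_const_card (c : R) : \sum_(i : T) c = #|T|%:R * c.
Proof. by rewrite sumr_const mulr_natl. Qed.

(** Adding the two signs cancels the cross terms and leaves [2 (e_i e_i^T + e_j e_j^T)], whose sum
    over all [i] and [j] is [4 #|T|] times the identity. *)
Lemma frame_E_sum x y : \sum_o frame_E o x y = (x == y)%:R.
Proof.
transitivity (\sum_i \sum_(j : T) (2 * #|T|%:R)^-1 *
   ((x == i)%:R * (y == i)%:R + (x == j)%:R * (y == j)%:R : R)).
  rewrite sum_frame; apply: eq_bigr => i _; apply: eq_bigr => j _.
  by rewrite /frame_E /frame_vec /= expr0 expr1; field.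
under eq_bigr => i _ do rewrite -mulr_sumr big_split /= sum_delta2 sum_const_card.
rewrite -mulr_sumr big_split /= sum_const_card -mulr_sumr sum_delta2.
by field.
Qed.

(** Subtracting the two signs isolates the cross terms: [#|T|] times the difference of the two
    effects for [(k, l)] is [h k l / 2]. On the diagonal these sum to the identity, so the
    correction term of [frame_D] integrates to 0. *)
Lemma frame_DE i j x y :
  \sum_o frame_D o i j * frame_E o x y = symdelta i j x y.
Proof.
pose h k l : R := (x == k)%:R * (y == l)%:R + (x == l)%:R * (y == k)%:R.
transitivity (\sum_k \sum_l
   ((i == k)%:R * ((j == l)%:R * (h k l / 2)) +
    (i == j)%:R / #|T|%:R *
     ((frame_E (k, l, false) x y + frame_E (k, l, true) x y) -
      (k == l)%:R * (h k l / 2)))).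
  rewrite sum_frame; apply: eq_bigr => k _; apply: eq_bigr => l _.
  by rewrite /frame_D /frame_E /frame_vec /h /= expr0 expr1; field.
under eq_bigr => k _.
  rewrite big_split /= -mulr_sumr.
  rewrite (sum_delta j (fun l => h k l / 2)) -mulr_sumr big_split /= sumrN.
  rewrite (sum_delta k (fun l => h k l / 2)).
over.
rewrite big_split /= (sum_delta i (fun k => h k j / 2)) -mulr_sumr big_split /=.
rewrite -(sum_frame (fun o => frame_E o x y)) frame_E_sum sumrN.
have -> : \sum_k h k k / 2 = (x == y)%:R.
  by rewrite -(sum_delta2 x y); apply: eq_bigr => k _; rewrite /h; field.
rewrite subrr mulr0 addr0 /h /symdelta.
by rewrite ![_ == x]eq_sym ![_ == y]eq_sym; congr (_ / _); ring.
Qed.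

Lemma frame_D_tr o : \sum_x frame_D o x x = 1.
Proof.
rewrite /frame_D big_split /= -mulr_sumr -mulr_sumr.
have -> : \sum_(x : T) (x == x)%:R = #|T|%:R :> R.
  by rewrite -[RHS]mulr1 -sum_const_card; apply: eq_bigr => x _; rewrite eqxx.
have -> : \sum_x (x == o.1.1)%:R * (x == o.1.2)%:R = (o.1.1 == o.1.2)%:R :> R.
  by rewrite -sum_delta2; apply: eq_bigr => x _; rewrite ![_ == x]eq_sym.
by field.
Qed.

Lemma sum_symdelta i j (G : T -> T -> R) :
  \sum_x \sum_y symdelta i j x y * G x y = (G i j + G j i) / 2.
Proof.
transitivity (\sum_x ((i == x)%:R * (\sum_y (j == y)%:R * (G x y / 2)) +
                      (j == x)%:R * (\sum_y (i == y)%:R * (G x y / 2)))).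
  apply: eq_bigr => x _; rewrite 2!mulr_sumr -big_split /=.
  by apply: eq_bigr => y _; rewrite /symdelta; field.
rewrite big_split /= !(sum_delta _ (fun x => \sum_y _ * (G x y / 2))).
by rewrite !(sum_delta _ (fun y => G _ y / 2)) mulrDl.
Qed.

End Frame.

(** On the compact part of [A] where [f] is at least [c], [g] has a positive minimum and [f] a
    maximum; [C] is the ratio of the excess of that maximum over [c] to that minimum. If this part
    is empty, [C = 0] works. *)
Lemma penalty_bound {R : realType} {V : topologicalType} (A : set V)
    (f g : V -> R) (c : R) :
  compact A -> continuous f -> continuous g ->
  (forall v, A v -> 0 <= g v) -> (forall v, A v -> g v = 0 -> f v < c) ->
  exists2 C, 0 <= C & forall v, A v -> f v <= c + C * g v.
Proof.
move=> cA cf cg g0 gf.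
pose A' := A `&` f @^-1` [set x | c <= x].
have cA' : compact A'.
  apply: compact_closedI => //; apply: preimage_closed; last exact: closed_ge.
  by move=> v _; exact: cf.
have [[w Aw]|A'0] := pselect (A' !=set0); last first.
  exists 0 => // v Av; rewrite mul0r addr0 leNgt; apply/negP => cv.
  by apply: A'0; exists v; split => //=; exact: ltW.
have [v0 /set_mem[Av0 cv0] min0] :
    exists2 v, v \in A' & forall t, t \in A' -> g v <= g t.
  by apply: compact_EVT_min => //; [exists w | exact: continuous_subspaceT].
have [v1 /set_mem[Av1 cv1] max1] :
    exists2 v, v \in A' & forall t, t \in A' -> f t <= f v.
  by apply: compact_EVT_max => //; [exists w | exact: continuous_subspaceT].
have gv0 : 0 < g v0.
  rewrite lt_neqAle g0 // andbT eq_sym; apply/eqP => gz.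
  by have := gf _ Av0 gz; rewrite ltNge cv0.
have C0 : 0 <= (f v1 - c) / g v0 by rewrite divr_ge0 ?subr_ge0 // ltW.
exists ((f v1 - c) / g v0) => // v Av.
have [cv|/ltW vc] := leP c (f v); last first.
  by apply: le_trans vc _; rewrite lerDl mulr_ge0 // g0.
have A'v : v \in A' by rewrite inE; split.
apply: (@le_trans _ _ (f v1)); first exact: max1.
rewrite -lerBlDl -[leLHS](divfK (lt0r_neq0 gv0)).
by apply: ler_wpM2l => //; exact: min0.
Qed.

(** * Rank-one relations and the empirical matrix *)

Section Limit.
Context {R : realType} {n m k : nat}.
Variables (X : 'M[R]_n) (Lam : {linear 'M[R]_n -> 'M[R]_m}) (Y : 'M[R]_m).
Notation T := (Pty n k).
Notation S := ((T * T) * bool)%type.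

Lemma rank_one_feasible (Z : T -> T -> R) :
  \sum_x Z x x = 1 ->
  (forall i j p q, Z i j * Z p q = Z i p * Z j q) ->
  Lam (tr2 Z) = Y -> xi_feasible k Lam Y (tr2 Z).
Proof.
move=> tr1 r1 LZ; split=> //.
have trZ : \tr (tr2 Z) = 1.
  by rewrite -tr1 sum_pty; apply: eq_bigr => i _; rewrite mxE.
have [x Zx] : exists x, Z x x != 0.
  apply/existsP; apply: contraT; rewrite negb_exists => /forallP H.
  move: tr1; rewrite big1 => [/esym/eqP|x _]; first by rewrite oner_eq0.
  by apply/eqP; rewrite -[_ == _]negbK.
(* The trace being 1, [Z x x] equals the sum over [y] of [Z x x * Z y y], that is, of the squares of
   [Z x y]. *)
have Zx0 : 0 < Z x x.
  rewrite lt_neqAle eq_sym Zx /= -[leRHS]mulr1 -tr1 mulr_sumr.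
  by apply: sumr_ge0 => y _; rewrite r1 -expr2 sqr_ge0.
(* Row [x] of [Z], normalised and reshaped into an [n] by [k] matrix; the relations give
   [Z a b = Z x a * Z x b / Z x x]. *)
pose F : 'M[R]_(n, k) := \matrix_(i, l) (Z x (i, l) / Num.sqrt (Z x x)).
have ZF : tr2 Z = F *m F^T.
  apply/matrixP => i j; rewrite !mxE; apply: eq_bigr => l _; rewrite !mxE.
  rewrite mulrACA -invfM -expr2 sqr_sqrtr ?ltW // -r1 mulrAC mulfV // mul1r //.
split=> //; split; last first.
  by rewrite ZF; apply: leq_trans (mxrankM_maxl _ _) (rank_leq_col _).
rewrite /psdmx.
have -> : (fun i j => tr2 Z i j) = (fun i j => \sum_l F i l * F j l).
  apply/funext => i; apply/funext => j; rewrite ZF mxE.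
  by apply: eq_bigr => l _; rewrite [F^T l j]mxE.
by apply: fpsd_sum => l; exact: fpsd_outer.
Qed.

(** Coefficients of the linear functional sending [Z] to the entry [ij] of
    [Lam (tr2 Z) - (\tr Z) Y]. *)
Definition gam (ij : 'I_m * 'I_m) (x y : T) : R :=
  Lam (tr2 (fun p p' => (x == p)%:R * (y == p')%:R)) ij.1 ij.2
  - Y ij.1 ij.2 * (x == y)%:R.

Lemma gam_sum ij (Z : T -> T -> R) :
  \sum_x \sum_y gam ij x y * Z x y
  = Lam (tr2 Z) ij.1 ij.2 - Y ij.1 ij.2 * \sum_x Z x x.
Proof.
have -> : tr2 Z = \sum_x \sum_y
   Z x y *: tr2 (fun p p' => (x == p)%:R * (y == p')%:R).
  transitivity (tr2 (fun p p' =>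
      \sum_x \sum_y Z x y * ((x == p)%:R * (y == p')%:R))).
    congr (tr2 _); apply/funext => p; apply/funext => p'.
    rewrite -(sum_delta p (fun x => Z x p')); apply: eq_bigr => x _.
    rewrite -(sum_delta p' (fun y => Z x y)) mulr_sumr.
    apply: eq_bigr => y _; rewrite [p == x]eq_sym [p' == y]eq_sym; ring.
  rewrite tr2_sum; apply: eq_bigr => x _; rewrite tr2_sum.
  by apply: eq_bigr => y _; rewrite tr2_scale.
rewrite linear_sum summxE mulr_sumr -sumrB; apply: eq_bigr => x _.
rewrite linear_sum summxE.
rewrite -(sum_delta x (fun y => Z x y)) mulr_sumr -sumrB.
by apply: eq_bigr => y _; rewrite linearZ mxE /gam; ring.
Qed.

(* Polynomials in Z whose common zeros with \tr Z = 1 are the matrices x x^T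
   coming from feasible points. *)
Definition relation (j : T * T * T * T + 'I_m * 'I_m) (Z : T -> T -> R) : R :=
  match j with
  | inl q => Z q.1.1.1 q.1.1.2 * Z q.1.2 q.2 - Z q.1.1.1 q.1.2 * Z q.1.1.2 q.2
  | inr ij => \sum_x \sum_y gam ij x y * Z x y
  end.

(** The two-outcome version of [relation], whose average over all pairs of parties is [relation] at
    the empirical matrix. In the linear case the second outcome is a dummy, so that both cases share
    one second-moment bound. *)
Definition kernel (j : T * T * T * T + 'I_m * 'I_m) (o o' : S) : R :=
  match j with
  | inl q => frame_D o q.1.1.1 q.1.1.2 * frame_D o' q.1.2 q.2
             - frame_D o q.1.1.1 q.1.2 * frame_D o' q.1.1.2 q.2
  | inr ij => \sum_x \sum_y gam ij x y * frame_D o x y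
  end.

Definition empirical {M : nat} (s : {ffun 'I_M -> S}) (x y : T) : R :=
  M%:R^-1 * \sum_t frame_D (s t) x y.

Lemma relation_empirical {M : nat} j (s : {ffun 'I_M -> S}) : (0 < M)%N ->
  relation j (empirical s)
  = M%:R ^- 2 * \sum_t \sum_t' kernel j (s t) (s t').
Proof.
move=> M0; have Mr : M%:R != 0 :> R by rewrite pnatr_eq0 -lt0n.
case: j => [[[[x y] z] w]|ij] /=.
  have E x1 y1 x2 y2 : empirical s x1 y1 * empirical s x2 y2 =
     M%:R ^- 2 * \sum_t \sum_t' frame_D (s t) x1 y1 * frame_D (s t') x2 y2.
    rewrite /empirical mulrACA -expr2 exprVn; congr (_ * _).
    by rewrite mulr_suml; apply: eq_bigr => t _; rewrite mulr_sumr.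
  rewrite !E -mulrBr -sumrB; congr (_ * _); apply: eq_bigr => t _.
  by rewrite sumrB.
under [X in _ = _ * X]eq_bigr => t _ do rewrite sumr_const card_ord -mulr_natl.
rewrite -mulr_sumr expr2 invfM -mulrA mulKf //.
rewrite [X in _ = _ * X]exchange_big mulr_sumr /=; apply: eq_bigr => x _.
rewrite [X in _ = _ * X]exchange_big mulr_sumr /=; apply: eq_bigr => y _.
by rewrite /empirical mulrCA -mulr_sumr.
Qed.

(** * Moments of the outcomes of a feasible point *)

Section Moments.
Variables (N : nat) (Phi : Idx n k N -> Idx n k N -> R).
Hypothesis T0 : (0 < #|{: T}|)%N.
Hypothesis feas : sdp_feasible Lam Y Phi.
Notation P := (outcome frame_E Phi).

Let Hsym s t a b : Phi (permi s a) (permi t b) = Phi a b.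
Proof. by move/sdp_feasibleP: feas => [_ _ ->]. Qed.

(** A transposition moves party [t] to the front on both sides, with [r] and [r'] independent of [x]
    and [y]; constraints stated for party A thus hold at every party. *)
Lemma Phi_upd (t : 'I_N.+1) (a b : Idx n k N) : exists r r', forall x y,
  Phi (upd a t x) (upd b t y) = Phi (join x r) (join y r').
Proof.
pose tau := tperm ord0 t.
have E (c : Idx n k N) x : upd c t x = permi tau (join x (rest (permi tau c))).
  apply/ffunP => i; rewrite !ffunE; case: (unliftP ord0 (tau i)) => [j ij|i0].
    have -> : (i == t) = false.
      by apply: contra_eqF ij => /eqP ->; rewrite /tau tpermR -(inj_eq val_inj).
    by rewrite !ffunE -ij /tau tpermK.
  by rewrite -[i](tpermK ord0 t) -/tau i0 /tau tpermL eqxx.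
exists (rest (permi tau a)), (rest (permi tau b)) => x y.
by rewrite !E Hsym.
Qed.

Lemma Phi_swap (t : 'I_N.+1) a b x y :
  Phi (upd a t x) (upd b t y) = Phi (upd a t y) (upd b t x).
Proof.
have [r [r' E]] := Phi_upd t a b; rewrite !E.
by move/sdp_feasibleP: feas => [_ _ _ ->].
Qed.

Lemma Phi_gam ij (t : 'I_N.+1) a b :
  \sum_x \sum_y gam ij x y * Phi (upd a t x) (upd b t y) = 0.
Proof.
have [r [r' E]] := Phi_upd t a b.
under eq_bigr => x _ do under eq_bigr => y _ do rewrite E.
rewrite (gam_sum ij (fun x y => Phi (join x r) (join y r'))).
by move/sdp_feasibleP: feas => [_ _ _ _ ->]; rewrite mxE mulrC subrr.
Qed.

Lemma updC (t t' : 'I_N.+1) (a : Idx n k N) x z : t != t' ->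
  upd (upd a t x) t' z = upd (upd a t' z) t x.
Proof.
move=> tt'; apply/ffunP => i; rewrite !ffunE.
by case: (eqVneq i t') => // ->; rewrite eq_sym (negPf tt').
Qed.

(** Duality of the frames turns the outcome sums into index deltas. A quadratic kernel becomes a
    difference of two entries of [Phi] that total symmetry identifies; a linear one becomes the
    constraint [Phi_gam] at party [t]. *)
Lemma kernel_vanish j (t t' : 'I_N.+1) (a b : Idx n k N) : t != t' ->
  \sum_(w : T * T) \sum_(v : T * T) (\sum_(o : S * S)
      kernel j o.1 o.2 * (frame_E o.1 v.1 w.1 * frame_E o.2 v.2 w.2)) *
      Phi (upd2 t t' a v) (upd2 t t' b w) = 0.
Proof.
move=> tt'.
(* Transposing one party and permuting the row indices generate all
   permutations of the four indices of G. *)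
pose G x z y w := Phi (upd2 t t' a (x, z)) (upd2 t t' b (y, w)).
have G1 x z y w : G x z y w = G y z x w.
  by rewrite /G /upd2 /= !(updC t t') // Phi_swap.
have G2 x z y w : G x z y w = G x w y z by rewrite /G /upd2 /= Phi_swap.
have G3 x z y w : G x z y w = G z x y w.
  rewrite /G -(Hsym (tperm t t') 1%g) permi1; congr (Phi _ _).
  apply/ffunP => i; rewrite !ffunE /=.
  case: tpermP => [->|->|/eqP nt /eqP nt'].
  - by rewrite eqxx (negPf tt') eqxx.
  - by rewrite eqxx (negPf tt') eqxx.
  - by rewrite (negPf nt) (negPf nt').
have split4 (F : T -> T -> T -> T -> R) :
    \sum_(w : T * T) \sum_(v : T * T) F v.1 v.2 w.1 w.2 =
    \sum_z \sum_w \sum_x \sum_y F x z y w.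
  transitivity (\sum_y \sum_w \sum_x \sum_z F x z y w).
    rewrite [RHS]pair_bigA; apply: eq_bigr => -[y w] _ /=.
    by rewrite [RHS]pair_bigA; apply: eq_bigr => -[].
  rewrite exchange_big /=.
  under eq_bigr => w _ do rewrite exchange_big /=.
  under eq_bigr => w _ do under eq_bigr => x _ do rewrite exchange_big /=.
  under eq_bigr => w _ do rewrite exchange_big /=.
  by rewrite exchange_big.
rewrite (split4 (fun x z y w => (\sum_(o : S * S) kernel j o.1 o.2 *
   (frame_E o.1 x y * frame_E o.2 z w)) * G x z y w)).
have prodS (f g : S -> R) :
    \sum_(o : S * S) f o.1 * g o.2 = (\sum_o f o) * (\sum_o g o).
  rewrite -(pair_bigA _ (fun o o' => f o * g o')) /= mulr_suml.
  by apply: eq_bigr => o _; rewrite mulr_sumr.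
case: j => [[[[i1 i2] i3] i4]|ij] /=.
  have K j1 j2 j3 j4 : \sum_z \sum_w \sum_x \sum_y
      (symdelta j1 j2 x y * symdelta j3 j4 z w) * G x z y w = G j1 j3 j2 j4.
    transitivity (\sum_z \sum_w symdelta j3 j4 z w *
        \sum_x \sum_y symdelta j1 j2 x y * G x z y w).
      apply: eq_bigr => z _; apply: eq_bigr => w _.
      rewrite mulr_sumr; apply: eq_bigr => x _.
      by rewrite mulr_sumr; apply: eq_bigr => y _; ring.
    under eq_bigr => z _ do under eq_bigr => w _ do
      rewrite (sum_symdelta j1 j2 (fun x y => G x z y w)) (G1 j2).
    rewrite (sum_symdelta j3 j4 (fun z w => (G j1 z j2 w + G j1 z j2 w) / 2)).
    by rewrite (G2 _ j4); field.
  transitivity (G i1 i3 i2 i4 - G i1 i2 i3 i4); last first.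
    by rewrite G1 G3 G1 subrr.
  rewrite -2!K -sumrB; apply: eq_bigr => z _; rewrite -sumrB.
  apply: eq_bigr => w _; rewrite -sumrB; apply: eq_bigr => x _.
  rewrite -sumrB; apply: eq_bigr => y _; rewrite -mulrBl; congr (_ * _).
  rewrite -!frame_DE // -!prodS -sumrB.
  by apply: eq_bigr => o _; ring.
(* The linear kernel ignores the outcome at [t'], so completeness of the effects puts a delta there
   and party [t'] is traced out. *)
transitivity (\sum_z \sum_w (z == w)%:R * (\sum_x' \sum_y' gam ij x' y' *
   \sum_x \sum_y symdelta x' y' x y * G x z y w)).
  apply: eq_bigr => z _; apply: eq_bigr => w _.
  have GD x y : \sum_(o : S) (\sum_x' \sum_y' gam ij x' y' * frame_D o x' y') *
      frame_E o x y = \sum_x' \sum_y' gam ij x' y' * symdelta x' y' x y.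
    under eq_bigr => o _ do rewrite mulr_suml.
    rewrite exchange_big /=; apply: eq_bigr => x' _.
    under eq_bigr => o _ do rewrite mulr_suml.
    rewrite exchange_big /=; apply: eq_bigr => y' _.
    by rewrite -frame_DE // mulr_sumr; apply: eq_bigr => o _; rewrite mulrA.
  transitivity (\sum_x \sum_y \sum_x' \sum_y' (z == w)%:R *
      (gam ij x' y' * (symdelta x' y' x y * G x z y w))).
    apply: eq_bigr => x _; apply: eq_bigr => y _.
    under eq_bigr => o _ do rewrite mulrA.
    rewrite (prodS (fun o => (\sum_x' \sum_y' gam ij x' y' * frame_D o x' y') *
      frame_E o x y) (fun o => frame_E o z w)) GD frame_E_sum //.
    rewrite !mulr_suml; apply: eq_bigr => x' _.
    by rewrite !mulr_suml; apply: eq_bigr => y' _; ring.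
  rewrite [LHS]pair_bigA [in RHS]pair_bigA /=.
  under eq_bigr => p _ do rewrite pair_bigA /=.
  rewrite exchange_big /= mulr_sumr; apply: eq_bigr => p' _.
  by rewrite -mulr_sumr -mulr_sumr [in RHS]pair_bigA.
apply: big1 => z _; rewrite (sum_delta z (fun w => \sum_x' \sum_y' gam ij x' y' *
   \sum_x \sum_y symdelta x' y' x y * G x z y w)).
rewrite -[RHS](Phi_gam ij t (upd a t' z) (upd b t' z)).
apply: eq_bigr => x _; apply: eq_bigr => y _.
rewrite (sum_symdelta x y (fun x y => G x z y z)) (G1 y); congr (_ * _).
by rewrite /G /upd2 /= !(updC t t') //; field.
Qed.

Let E_ge0 : 0 <= (4 * #|{: T}|%:R)^-1 :> R.
Proof. by rewrite invr_ge0 mulr_ge0 ?ler0n. Qed.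

Lemma outcome_feasible_ge0 s : 0 <= P s.
Proof.
case/sdp_feasibleP: feas => psd _ _ _ _.
exact: (outcome_ge0 frame_E Phi frame_vec (4 * #|{: T}|%:R)^-1).
Qed.

Lemma outcome_feasible_sum1 : \sum_s P s = 1.
Proof.
case/sdp_feasibleP: feas => _ tr1 _ _ _.
by apply: outcome_sum1 => // x y; exact: frame_E_sum.
Qed.

(** The sum of all absolute values serves as a crude uniform bound on the kernel, depending on
    neither [N] nor [Phi]. *)
Lemma expect_relation j :
  \sum_s P s * relation j (empirical s) ^+ 2
    <= 5 * (\sum_o \sum_o' `|kernel j o o'|) ^+ 2 / N.+1%:R.
Proof.
under eq_bigr => s _ do rewrite relation_empirical //.
apply: second_moment_bound => //;
  [exact: outcome_feasible_ge0 | exact: outcome_feasible_sum1 | |].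
  move=> o o'; rewrite (bigD1 o) //= (bigD1 o') //= -addrA lerDl.
  by rewrite addr_ge0 ?sumr_ge0 // => ? _; rewrite sumr_ge0.
move=> t1 t2 t3 t4 t12 t31 t32 t41 t42.
apply: (expect_vanish _ _ _ _ _ (fun s => kernel j (s t3) (s t4))) => //.
  by move=> s v; rewrite !ffunE (negPf t31) (negPf t32) (negPf t41) (negPf t42).
by move=> a b; exact: kernel_vanish.
Qed.

Lemma redA_sym p p' : redA Phi p p' = redA Phi p' p.
Proof.
by case/sdp_feasibleP: feas => -[Ps _] _ _ _ _; apply: eq_bigr => r _; rewrite Ps.
Qed.

(** The objective is linear in the empirical matrix, hence an average of one-party expectations, all
    equal by exchangeability. The frames recover only the symmetric part of [redA Phi], which is
    symmetric already. *)
Lemma expect_objective :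
  \sum_s P s * \tr (X *m tr2 (empirical s)) = ftr (fmul (@XA R n k X N) Phi).
Proof.
pose f (o : S) : R := \sum_p \sum_p' Xt X p p' * frame_D o p' p.
have M0 : N.+1%:R != 0 :> R by rewrite pnatr_eq0.
have fE (s : {ffun 'I_N.+1 -> S}) :
    \tr (X *m tr2 (empirical s)) = N.+1%:R^-1 * \sum_t f (s t).
  rewrite -Xt_tr2 /f [X in _ = _ * X]exchange_big mulr_sumr /=.
  apply: eq_bigr => p _; rewrite [X in _ = _ * X]exchange_big mulr_sumr /=.
  by apply: eq_bigr => p' _; rewrite /empirical mulrCA -mulr_sumr.
transitivity (N.+1%:R^-1 * \sum_t \sum_s P s * f (s t)).
  rewrite exchange_big mulr_sumr /=; apply: eq_bigr => s _.
  by rewrite fE -mulr_sumr mulrCA.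
have Ef t : \sum_s P s * f (s t) = ftr (fmul (@XA R n k X N) Phi).
  rewrite expect_any //; last by move=> x y; exact: frame_E_sum.
  rewrite ftr_XA -Xt_tr2.
  transitivity (\sum_p \sum_p' \sum_q \sum_q' Xt X q q' *
     (symdelta q' q p p' * redA Phi p p')).
    apply: eq_bigr => p _; apply: eq_bigr => p' _.
    rewrite /f; under eq_bigr => o _ do rewrite mulr_suml.
    rewrite exchange_big mulr_suml /=; apply: eq_bigr => q _.
    under eq_bigr => o _ do rewrite mulr_suml.
    rewrite exchange_big mulr_suml /=; apply: eq_bigr => q' _.
    rewrite -frame_DE // mulrA mulr_sumr; congr (_ * _).
    by apply: eq_bigr => o _; rewrite mulrA.
  rewrite [LHS]pair_bigA [RHS]pair_bigA /=.
  under eq_bigr => p _ do rewrite pair_bigA /=.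
  rewrite exchange_big /=; apply: eq_bigr => q _.
  rewrite -mulr_sumr -[X in _ * X = _](pair_bigA _
    (fun p p' => symdelta q.2 q.1 p p' * redA Phi p p')) /= sum_symdelta.
  by rewrite (redA_sym q.1); congr (_ * _); field.
under eq_bigr => t _ do rewrite Ef.
by rewrite sumr_const card_ord -[X in _ * X = _]mulr_natl mulKf.
Qed.

End Moments.

Lemma empirical_tr {M : nat} (s : {ffun 'I_M -> S}) : (0 < M)%N ->
  (0 < #|{: T}|)%N -> \sum_x empirical s x x = 1.
Proof.
move=> M0 T0; rewrite -mulr_sumr exchange_big /=.
under eq_bigr => t _ do rewrite frame_D_tr //.
by rewrite sumr_const card_ord mulVf // pnatr_eq0 -lt0n.
Qed.

Lemma empirical_bound {M : nat} (s : {ffun 'I_M -> S}) x y : (0 < M)%N ->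
  `|empirical s x y| <= \sum_(o : S) \sum_x' \sum_y' `|frame_D o x' y' : R|.
Proof.
move=> M0; have Mr : 0 < M%:R :> R by rewrite ltr0n.
rewrite normrM [`|M%:R^-1|]gtr0_norm ?invr_gt0 // ler_pdivrMl //.
apply: le_trans (ler_norm_sum _ _ _) _.
rewrite mulr_natl -[X in _ *+ X](card_ord M) -sumr_const; apply: ler_sum => t _.
rewrite (bigD1 (s t)) //= (bigD1 x) //= (bigD1 y) //= -!addrA lerDl.
by rewrite !addr_ge0 ?sumr_ge0 // => *; do ?[apply: sumr_ge0 => * //].
Qed.

Lemma xiSDP_upper (c : R) : (0 < #|{: T}|)%N -> (xi_val k X Lam Y < c%:E)%E ->
  exists C : R, forall N, (xiSDP k X Lam Y N <= (c + C / N.+1%:R)%:E)%E.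
Proof.
move=> T0 xic.
pose B : R := \sum_(o : S) \sum_x' \sum_y' `|frame_D o x' y' : R|.
(* Matrices on [T] are coded as row vectors, for which [rV_compact] gives compactness of the box. *)
pose Zof (v : 'rV[R]_#|{: T * T}|) x y : R := v ord0 (enum_rank (x, y)).
pose f v : R := \sum_p \sum_p' Xt X p p' * Zof v p' p.
pose g v : R := \sum_j relation j (Zof v) ^+ 2 + (\sum_x Zof v x x - 1) ^+ 2.
pose box := [set v : 'rV[R]_#|{: T * T}| | forall i, `[- B, B]%classic (v ord0 i)].
have [C C0 fC] : exists2 C, 0 <= C & forall v, box v -> f v <= c + C * g v.
  have csum (I : finType) (F : I -> 'rV[R]_#|{: T * T}| -> R) :
      (forall i, continuous (F i)) -> continuous (fun v => \sum_i F i v).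
    by move=> cF; apply: continuous_big => //; exact: add_continuous.
  have cZ x y : continuous (fun v => Zof v x y) by exact: coord_continuous.
  have cst (r : R) : continuous (fun _ : 'rV[R]_#|{: T * T}| => r).
    exact: cst_continuous.
  have cM (h h' : 'rV[R]_#|{: T * T}| -> R) : continuous h -> continuous h' ->
      continuous (fun v => h v * h' v).
    by move=> ch ch' v; exact: (continuousM (ch v) (ch' v)).
  have cB (h h' : 'rV[R]_#|{: T * T}| -> R) : continuous h -> continuous h' ->
      continuous (fun v => h v - h' v).
    by move=> ch ch' v; exact: (continuousB (ch v) (ch' v)).
  have crel j : continuous (fun v => relation j (Zof v)).
    case: j => [q|ij] /=; first by apply: (@cB); apply: (@cM); exact: cZ.
    by apply: (@csum) => x; apply: (@csum) => y; apply: (@cM).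
  apply: penalty_bound.
  - apply: (@rV_compact R _ (fun=> `[- B, B]%classic)) => i.
    exact: segment_compact.
  - by apply: (@csum) => p; apply: (@csum) => p'; apply: (@cM).
  (* Squares become products and the last sum a difference, the shapes covered by [cM] and [cB]. *)
  - have -> : g = fun v => \sum_j relation j (Zof v) * relation j (Zof v) -
        ((0 - (\sum_x Zof v x x - 1)) * (\sum_x Zof v x x - 1)).
      by apply/funext => v; rewrite /g expr2 sub0r mulNr opprK.
    apply: (@cB); first by apply: (@csum) => j; exact: (@cM).
    by apply: (@cM); do ?[apply: (@cB) => //]; apply: (@csum).
  - by move=> v _; rewrite addr_ge0 ?sqr_ge0 // sumr_ge0 // => j _; exact: sqr_ge0.
  (* A zero of [g] has trace 1 and satisfies every relation, so it comes from a feasible point and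
     its objective value is at most [xi], below [c]. *)
  move=> v _ /eqP.
  rewrite paddr_eq0 ?sqr_ge0 ?sumr_ge0 // => [/andP[/eqP r0]|j _];
    last exact: sqr_ge0.
  rewrite sqrf_eq0 subr_eq0 => /eqP tr1.
  have rel0 j : relation j (Zof v) = 0.
    apply/eqP; rewrite -sqrf_eq0; apply/eqP.
    by apply: (psumr_eq0P _ r0) => // j' _; exact: sqr_ge0.
  rewrite -lte_fin; apply: le_lt_trans xic; rewrite /f Xt_tr2.
  apply: ereal_sup_ubound; exists (tr2 (Zof v)) => //.
  apply: rank_one_feasible => //.
    move=> i j p q; apply/eqP; rewrite -subr_eq0; apply/eqP.
    exact: (rel0 (inl (i, j, p, q))).
  apply/matrixP => i j; have := rel0 (inr (i, j)).
  by rewrite /= gam_sum tr1 mulr1 /= => /eqP; rewrite subr_eq0 => /eqP.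
exists (C * \sum_j 5 * (\sum_(o : S) \sum_(o' : S) `|kernel j o o'|) ^+ 2) => N.
apply: ge_ereal_sup => _ [Phi feas <-]; rewrite lee_fin.
rewrite -(expect_objective _ _ T0 feas).
(* The penalty bound holds for each outcome sequence, the empirical matrix lying in the box and
   having trace 1; it is then averaged. *)
apply: (@le_trans _ _ (\sum_s outcome frame_E Phi s *
   (c + C * \sum_j relation j (empirical s) ^+ 2))).
  apply: ler_sum => s _; apply: ler_wpM2l; first exact: outcome_feasible_ge0 feas _.
  pose v : 'rV[R]_#|{: T * T}| :=
    \row_i empirical s (enum_val i).1 (enum_val i).2.
  have Zv : Zof v = empirical s.
    by apply/funext => x; apply/funext => y; rewrite /Zof mxE enum_rankK.
  have := fC v; rewrite /f /g Zv Xt_tr2 empirical_tr // subrr expr0n addr0; apply.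
  by move=> i; rewrite /= mxE in_itv /= -ler_norml; exact: empirical_bound.
under eq_bigr => s _ do rewrite mulrDr.
rewrite big_split /= -mulr_suml (outcome_feasible_sum1 _ _ T0 feas) mul1r lerD2l.
under eq_bigr => s _ do rewrite mulrCA.
rewrite -[leLHS]mulr_sumr -[leRHS]mulrA; apply: ler_wpM2l => //.
under [leLHS]eq_bigr => s _ do rewrite mulr_sumr.
rewrite exchange_big /= mulr_suml; apply: ler_sum => j _.
exact: expect_relation.
Qed.

End Limit.

Lemma xiSDP_cvg {R : realType} {n m k : nat} (X : 'M[R]_n)
    (Lam : {linear 'M[R]_n -> 'M[R]_m}) (Y : 'M[R]_m) :
  (0 < n)%N -> (0 < k)%N ->
  xiSDP k X Lam Y N @[N --> \oo] --> xi_val k X Lam Y.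
Proof.
move=> n0 k0.
have T0 : (0 < #|{: Pty n k}|)%N by rewrite card_prod !card_ord muln_gt0 n0.
set u := xiSDP k X Lam Y; set xi := xi_val k X Lam Y.
suff <- : ereal_inf (range u) = xi.
  apply: ereal_nonincreasing_cvgn; apply/nonincreasing_seqP => N.
  exact: xiSDP_nonincreasing.
apply/eqP; rewrite eq_le; apply/andP; split; last first.
  by apply: le_ereal_inf_tmp => _ [N _ <-]; exact: xi_val_le_xiSDP.
(* Given [e > 0], some [N] has [C / N.+1] at most [e], so the infimum is at most [c + e] for every
   [e]. *)
have inf_le (c : R) : (xi < c%:E)%E -> (ereal_inf (range u) <= c%:E)%E.
  move=> /(xiSDP_upper _ _ _ _ T0)[C uC]; apply/lee_addgt0Pr => e e0.
  pose N := Num.bound (`|C| / e).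
  apply: (@le_trans _ _ (u N)); first by apply: ereal_inf_lbound; exists N.
  apply: le_trans (uC N) _; rewrite -EFinD lee_fin lerD2l ler_pdivrMr ?ltr0n //.
  apply: le_trans (ler_norm _) _; rewrite mulrC -ler_pdivrMr //.
  apply: le_trans (ltW (archi_boundP _)) _; first by rewrite divr_ge0 // ltW.
  by rewrite ler_nat.
(* If [xi] is [-oo], a finite infimum [l] is refuted by [c = l - 1], and an infinite one by
   [c = 0]. *)
case: (xi) inf_le => [r| |] inf_le; last 2 first.
- exact: leey.
- case: (ereal_inf _) inf_le => [l| |] // inf_le.
    by exfalso; move: (inf_le (l - 1) (ltNyr _)); rewrite lee_fin; lra.
  by have := inf_le 0 (ltNyr _).
apply/lee_addgt0Pr => e e0; rewrite -EFinD; apply: inf_le.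
by rewrite lte_fin ltrDl.
Qed.

Local Open Scope ereal_scope.

Theorem theorem4 (R : realType) (n m k : nat)
  (hn : (0 < n)%N) (hm : (0 < m)%N) (hk : (0 < k)%N)
  (X : 'M[R]_n) (hX : X^T = X)
  (Lam : {linear 'M[R]_n -> 'M[R]_m}) (Y : 'M[R]_m) :
  (forall N : nat, @xi_val R n m k X Lam Y <= @xiSDP R n m k X Lam Y N) /\
  (forall N : nat, @xiSDP R n m k X Lam Y N.+1 <= @xiSDP R n m k X Lam Y N) /\
  (@xiSDP R n m k X Lam Y N @[N --> \oo] --> @xi_val R n m k X Lam Y).
Proof.
split; first exact: xi_val_le_xiSDP.
split; first exact: xiSDP_nonincreasing.
exact: xiSDP_cvg.
Qed.
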